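(* Let $a,b,c$ be real numbers with $c\le a<0$ and $b\in\mathbb{R}$, let $k\ge 1$ be an integer, and let $R(z)=\sum_{i=1}^k a_{2i}z^{2i}$ with $a_{2i}>0$ for $i=1,\dots,k$. Then for the vector field $$F(x,y,z)=(y,-x,0)+\big((ax+by)R(z),\,(-bx+cy)R(z),\,-zR(z)\big)$$ on $\mathbb{R}^3$ the origin is an almost global attractor which is not locally asymptotically stable.
   Context: For a differential equation $\dot x=F(x)$ with $F:\mathbb{R}^n\to\mathbb{R}^n$ of class $C^1$ and $F(0)=0$, the origin is an almost global attractor if all trajectories, except for a set of initial states with zero Lebesgue measure, converge to the origin (as $t\to+\infty$). *)

(* Defs.v *)
From HB Require Import structures.
From mathcomp Require Import all_boot all_order all_algebra.
From mathcomp Require Import all_classical all_reals all_analysis.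

Set Implicit Arguments.
Unset Strict Implicit.
Unset Printing Implicit Defensive.

Import Order.TTheory GRing.Theory Num.Theory.
Import numFieldNormedType.Exports.

Local Open Scope classical_set_scope.
Local Open Scope ring_scope.

(* [X] solves X' = F(X) on [0, +oo[ with X 0 = p. Only the restriction of [X]
   to [0, +oo[ matters; as F is continuous in the cases of interest, the
   equation then also holds at 0 with the right derivative. *)
Definition forward_solution (R : realType) (V : normedModType R) (F : V -> V)
    (p : V) (X : R -> V) : Prop :=
  [/\ X 0 = p,
      {within `[0, +oo[%classic, continuous X} &
      forall t : R, 0 < t -> is_derive t 1 X (F (X t))].

(* The trajectory of [p] is defined for all t >= 0 and satisfies [P]. For F of
   class C^1 the solution is unique; in general, all of them must satisfy [P].
   The existence clause excludes initial states whose solution blows up in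
   finite time, for which the second clause would hold vacuously. *)
Definition trajectory_satisfies (R : realType) (V : normedModType R)
    (F : V -> V) (P : (R -> V) -> Prop) (p : V) : Prop :=
  (exists X, forward_solution F p X) /\
  (forall X, forward_solution F p X -> P X).

Definition converges_to_origin (R : realType) (V : normedModType R)
    (X : R -> V) : Prop := X t @[t --> +oo] --> (0 : V).

Definition lyapunov_stable (R : realType) (V : normedModType R)
    (F : V -> V) : Prop :=
  forall e : R, 0 < e -> exists2 d : R, 0 < d &
    forall p : V, `|p| < d ->
      trajectory_satisfies F (fun X => forall t, 0 <= t -> `|X t| < e) p.

Definition locally_attractive (R : realType) (V : normedModType R)
    (F : V -> V) : Prop :=
  exists2 d : R, 0 < d &
    forall p : V, `|p| < d ->
      trajectory_satisfies F (@converges_to_origin R V) p.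

Definition locally_asymptotically_stable (R : realType) (V : normedModType R)
    (F : V -> V) : Prop := lyapunov_stable F /\ locally_attractive F.

(* R^3 is R * R * R, whose norm is the sup norm. *)
Definition lebesgue_measure3 (R : realType) :
    set (measurableTypeR R * measurableTypeR R * measurableTypeR R) -> \bar R :=
  ((@lebesgue_measure R \x @lebesgue_measure R) \x @lebesgue_measure R)%E.

Definition almost_global_attractor (R : realType)
    (F : R * R * R -> R * R * R) : Prop :=
  (@lebesgue_measure3 R).-negligible
    [set p | ~ trajectory_satisfies F (@converges_to_origin R _) p].

(* R(z) = \sum_(1 <= i <= k) a_{2i} z^{2i}; the values of [a] at 0 and at odd
   indices are not used. *)
Definition even_poly_fun (R : realType) (k : nat) (a : nat -> R) (z : R) : R :=
  \sum_(1 <= i < k.+1) a (2 * i)%N * z ^+ (2 * i).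

Definition vector_field (R : realType) (a b c : R) (Rz : R -> R)
    (p : R * R * R) : R * R * R :=
  let: (x, y, z) := p in
  (y, - x, 0) +
  ((a * x + b * y) * Rz z, (- b * x + c * y) * Rz z, - z * Rz z).

(* Main.v *)
Require Import Defs.
From mathcomp Require Import all_boot all_order all_algebra.
From mathcomp Require Import all_classical all_reals all_analysis.
From mathcomp Require Import ring lra.

(** Off the plane [z = 0] the field acts on the squared height [w = z^2] and on
the squared radius [r = x^2 + y^2] by
[w' = - 2 R(z) w] and [r' = 2 R(z) (a x^2 + c y^2) <= 2 a R(z) r]: the
rotation and the coefficient [b] drop out.

The height tends to 0 without reaching it.  As [w] does not increase, [R(z)] is
bounded along the trajectory, so [w] is at least a decaying exponential and
stays positive ([height_sq_gt0]); as [R(z) >= a_2 w], the derivative of [1 / w]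
is at least [2 a_2], so [w] tends to 0 ([height_sq_decay]).  The radius is
driven by the height: [r w^a] does not increase ([radius_bound]), so [r] is at
most a constant times [w^(-a)], which tends to 0 with [w] because [a < 0].
Hence every trajectory that starts off the plane converges to the origin
([converges_off_plane]), and the plane is a null set ([negligible_plane]).  In
the plane the field is a pure rotation, whose circles of arbitrarily small
radius do not converge ([not_locally_attractive]).

Trajectories defined for all times must also be shown to exist
([flow_exists]).  The system is triangular: [z] solves a scalar autonomous
equation, and once [z] is known, [(x, y)] solves a linear equation with bounded
continuous coefficients.  Truncating the first equation outside [[-|z0|, |z0|]],
an interval its solution never leaves, makes both equations globally Lipschitz
in the state, and Picard iteration solves them on the whole half-line
([picard]).  Its estimates use the comparison weight [e^(2 L t)], for which each
iteration halves the error. *)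

Set Implicit Arguments.
Unset Strict Implicit.
Unset Printing Implicit Defensive.

Import Order.TTheory GRing.Theory Num.Theory.
Import numFieldNormedType.Exports.

Local Open Scope ring_scope.
Local Open Scope classical_set_scope.

(** * Derivatives of curves *)

Section Calculus.
Variable R : realType.
Implicit Types V W : normedModType R.

Lemma is_deriveE V (f : R -> V) (t : R) (l : V) :
  is_derive t 1 f l <->
  h^-1 *: ((f \o shift t) (h *: 1) - f t) @[h --> 0^'] --> l.
Proof.
split=> [[df <-]|H]; first exact: df.
have dv : derivable f t 1 by apply/cvg_ex; exists l.
by split => //; apply: cvg_lim.
Qed.

Lemma is_derive_pair V W (f : R -> V) (g : R -> W) (t : R) l m :
  is_derive t 1 f l -> is_derive t 1 g m ->
  is_derive t 1 (fun s => (f s, g s)) (l, m).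
Proof.
move=> /is_deriveE df /is_deriveE dg; apply/is_deriveE.
exact: (cvg_pair df dg).
Qed.

Lemma is_derive_fst V W (f : R -> V * W) (t : R) l :
  is_derive t 1 f l -> is_derive t 1 (fun s => (f s).1) l.1.
Proof.
move=> /is_deriveE df; apply/is_deriveE.
exact: (cvg_comp _ _ df (@cvg_fst _ _ _ _ _)).
Qed.

Lemma is_derive_snd V W (f : R -> V * W) (t : R) l :
  is_derive t 1 f l -> is_derive t 1 (fun s => (f s).2) l.2.
Proof.
move=> /is_deriveE df; apply/is_deriveE.
exact: (cvg_comp _ _ df (@cvg_snd _ _ _ _ _)).
Qed.

Lemma is_derive_mull (m t : R) : is_derive t 1 (fun s => m * s) m.
Proof.
rewrite -[X in is_derive _ _ _ X]mulr1.
by apply: is_deriveZ; exact: is_derive_id.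
Qed.

Lemma is_derive_expR_mull (m t : R) :
  is_derive t 1 (fun s => expR (m * s)) (m * expR (m * t)).
Proof.
rewrite mulrC.
exact: (is_derive1_comp (f := @expR R) (is_derive_expR _) (is_derive_mull m t)).
Qed.

Lemma nondecreasing_forward (f df : R -> R) :
  f s @[s --> 0^'+] --> f 0 ->
  (forall t : R, 0 < t -> is_derive t 1 f (df t)) ->
  (forall t : R, 0 < t -> 0 <= df t) ->
  forall t : R, 0 <= t -> f 0 <= f t.
Proof.
move=> f0 dfE df0 t t0.
apply: (@ger0_derive1_ndecry _ f 0) => // [x|x|].
- by rewrite in_itv/= andbT => x0; have [] := dfE _ x0.
- rewrite in_itv/= andbT => x0.
  by rewrite derive1E; have [_ ->] := dfE _ x0; apply: df0.
- apply/continuous_within_itvcyP; split => // x; rewrite in_itv/= andbT => x0.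
  by apply/differentiable_continuous/derivable1_diffP; have [] := dfE x x0.
Qed.

Lemma growth_bound_real (D d G g : R -> R) : continuous D -> continuous G ->
  (forall t : R, 0 < t -> is_derive t 1 D (d t)) ->
  (forall t : R, 0 < t -> is_derive t 1 G (g t)) ->
  `|D 0| <= G 0 -> (forall t : R, 0 < t -> `|d t| <= g t) ->
  forall t : R, 0 <= t -> `|D t| <= G t.
Proof.
move=> cD cG dD dG DG0 dg t t0.
have H1 : (G \- D) 0 <= (G \- D) t.
  apply: (@nondecreasing_forward _ (fun s => g s - d s)) => // [|s s0|].
  - exact: (cvg_at_right_filter (continuousB (cG 0) (cD 0))).
  - exact: is_deriveB (dG _ s0) (dD _ s0).
  - move=> s s0; rewrite subr_ge0; apply: le_trans (dg _ s0).
    exact: ler_norm.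
have H2 : (G \+ D) 0 <= (G \+ D) t.
  apply: (@nondecreasing_forward _ (fun s => g s + d s)) => // [|s s0|].
  - exact: (cvg_at_right_filter (continuousD (cG 0) (cD 0))).
  - exact: is_deriveD (dG _ s0) (dD _ s0).
  - move=> s s0; rewrite -[d s]opprK subr_ge0; apply: le_trans (dg _ s0).
    by rewrite -normrN ler_norm.
move: DG0 H1 H2 => /=; rewrite !ler_norml => /andP[? ?] ? ?.
by apply/andP; split; lra.
Qed.

(** The derivative is prescribed at positive times only and the primitive is
frozen before time 0: this is what the notion of forward solution sees, and it
lets all functions be continuous on the whole line. *)
Definition forward_primitive V (f F : R -> V) : Prop :=
  [/\ continuous F, forall t : R, t <= 0 -> F t = 0 &
      forall t : R, 0 < t -> is_derive t 1 F (f t)].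

Lemma forward_primitive_real (f : R -> R) : continuous f ->
  exists F, forward_primitive f F.
Proof.
move=> cf.
pose P (x : R) :=
  (\int[@lebesgue_measure R]_(t in [set` `[(-1)%R, x]]) (f t))%R.
have dP (x : R) : -1 < x -> is_derive x 1 P (f x).
  move=> x1.
  have [] := @continuous_FTC1_closed R f (-1) x (x+1) _ _ x1 (cf x).
  - by rewrite ltrDl.
  - apply: continuous_compact_integrable; first exact: segment_compact.
    exact: continuous_subspaceT.
  move=> dP; rewrite derive1E => <-; split => //.
have cP (x : R) : -1 < x -> {for x, continuous P}.
  move=> x1; apply/differentiable_continuous/derivable1_diffP.
  by have [] := dP x x1.
(* The integral starts at -1, so that P is differentiable at 0 as well, and
   then P (max t 0) is continuous there. *)
exists (fun t => P (Num.max t 0) - P 0); split.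
- move=> x; apply: cvgB; last exact: cvg_cst.
  have cmax : {for x, continuous (fun t : R => Num.max t 0)}.
    by apply: continuous_max; [exact: cvg_id|exact: cvg_cst].
  apply: (cvg_comp (fun t : R => Num.max t 0) P cmax).
  apply: cP; rewrite lt_max; apply/orP; right; lra.
- by move=> t t0; rewrite (max_idPr t0) subrr.
- move=> t t0.
  have dPt : is_derive t 1 (fun s => P s - P 0) (f t).
    rewrite -[f t]subr0; apply: (is_deriveB _ (is_derive_cst (P 0) t 1)).
    apply: dP; lra.
  move: dPt => /is_deriveE dPt; apply/is_deriveE.
  rewrite /= (max_idPl (ltW t0)).
  apply: cvg_trans dPt; apply: near_eq_cvg.
  have : \forall h \near (0:R)^', - t < h.
    have : \forall h \near (0:R)^', `|h| < t by exact: dnbhs0_lt.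
    by apply: filterS => h; rewrite ltr_norml => /andP[].
  apply: filterS => h /= ht.
  rewrite (max_idPl _) //= /GRing.scale /= mulr1; lra.
Qed.
End Calculus.

(** * Spaces with enough calculus for Picard iteration *)

(** Picard iteration needs three facts about the state space: summable
sequences converge, continuous curves have primitives, and a curve is bounded
by any primitive of a bound on its speed.  They pass to finite products, so
integration of real functions gives them for the line and for the plane. *)
Record calculus_space (R : realType) (V : normedModType R) : Prop := {
  geometric_cvg : forall (v : nat -> V) (C : R),
    (forall n, `|v n.+1 - v n| <= C * 2^-1 ^+ n) ->
    exists l : V, v @ \oo --> l;
  primitive_ex : forall f : R -> V, continuous f ->
    exists F, forward_primitive f F;
  growth_bound : forall (D d : R -> V) (G g : R -> R),
    continuous D -> continuous G ->
    (forall t : R, 0 < t -> is_derive t 1 D (d t)) ->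
    (forall t : R, 0 < t -> is_derive t 1 G (g t)) ->
    `|D 0| <= G 0 -> (forall t : R, 0 < t -> `|d t| <= g t) ->
    forall t : R, 0 <= t -> `|D t| <= G t }.

Section Spaces.
Variable R : realType.

Lemma calculus_space_real : calculus_space R.
Proof.
split; [|exact: forward_primitive_real|exact: growth_bound_real].
move=> v C vC.
have C0 : 0 <= C by have := vC 0%N; rewrite expr0 mulr1; apply: le_trans.
have : cvgn (series (telescope v)).
  apply: normed_cvg.
  apply: (@series_le_cvg _ _ (geometric C 2^-1)) => [n|n|n|] //=.
  - by rewrite mulr_ge0// exprn_ge0// invr_ge0.
  - exact: vC.
  - by apply: is_cvg_geometric_series; rewrite ger0_norm; lra.
move=> /cvg_ex[l hl]; exists (v 0%N + l).
rewrite [X in X @ _](_ : _ = (fun n => v 0%N + series (telescope v) n)).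
  by apply: cvgD => //; exact: cvg_cst.
by apply/funext => n; exact: eq_sum_telescope.
Qed.

Lemma continuous_pair (T U V : topologicalType) (f : T -> U) (g : T -> V) :
  continuous f -> continuous g -> continuous (fun t => (f t, g t)).
Proof. by move=> cf cg t; apply: cvg_pair; [exact: cf|exact: cg]. Qed.

Lemma continuous_fst (T U V : topologicalType) (f : T -> U * V) :
  continuous f -> continuous (fun t => (f t).1).
Proof. move=> cf t; exact: (cvg_comp _ _ (cf t) (@cvg_fst _ _ _ _ _)). Qed.

Lemma continuous_snd (T U V : topologicalType) (f : T -> U * V) :
  continuous f -> continuous (fun t => (f t).2).
Proof. move=> cf t; exact: (cvg_comp _ _ (cf t) (@cvg_snd _ _ _ _ _)). Qed.

Lemma prod_norm_le (V W : normedModType R) (p : V * W) (c : R) :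
  (`|p| <= c) = (`|p.1| <= c) && (`|p.2| <= c).
Proof. by rewrite prod_normE ge_max. Qed.

Lemma calculus_space_prod (V W : normedModType R) :
  calculus_space V -> calculus_space W -> calculus_space (V * W)%type.
Proof.
move=> cV cW; split.
- move=> v C vC.
  have [|l hl] := geometric_cvg cV (v := fun n => (v n).1) (C := C).
    by move=> n; have := vC n; rewrite prod_norm_le => /andP[].
  have [|m hm] := geometric_cvg cW (v := fun n => (v n).2) (C := C).
    by move=> n; have := vC n; rewrite prod_norm_le => /andP[].
  exists (l, m).
  rewrite [X in X @ _](_ : _ = fun n => ((v n).1, (v n).2)).
    exact: cvg_pair.
  by apply/funext => n; case: (v n).
- move=> f cf.
  have [F [cF F0 dF]] := primitive_ex cV (continuous_fst cf).
  have [G [cG G0 dG]] := primitive_ex cW (continuous_snd cf).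
  exists (fun t => (F t, G t)); split.
  + exact: continuous_pair.
  + by move=> t t0; rewrite F0 ?G0.
  + move=> t t0; rewrite [f t]surjective_pairing.
    by apply: is_derive_pair; [exact: dF|exact: dG].
- move=> D d G g cD cG dD dG; rewrite prod_norm_le => /andP[D1 D2] dg t t0.
  rewrite prod_norm_le; apply/andP; split.
  + apply: (growth_bound cV (D := fun t => (D t).1)
      (d := fun t => (d t).1) (G := G) (g := g)) => //.
    * exact: continuous_fst.
    * by move=> s s0; apply: is_derive_fst; exact: dD.
    * by move=> s /dg; rewrite prod_norm_le => /andP[].
  + apply: (growth_bound cW (D := fun t => (D t).2)
      (d := fun t => (d t).2) (G := G) (g := g)) => //.
    * exact: continuous_snd.
    * by move=> s s0; apply: is_derive_snd; exact: dD.
    * by move=> s /dg; rewrite prod_norm_le => /andP[].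
Qed.
End Spaces.

(** * Picard iteration *)

Lemma half_pow_small (R : realType) (C e : R) : 0 < e ->
  exists n, C * 2^-1 ^+ n < e.
Proof.
move=> e0.
have h : `|2^-1 : R| < 1 by rewrite ger0_norm; lra.
have /cvgr0Pnorm_lt/(_ _ e0)[n _ hn] := @cvg_geometric R C _ h.
by exists n; apply: le_lt_trans (hn n (leqnn n)); exact: ler_norm.
Qed.

Lemma half_pow_bound_eq0 (R : realType) (V : normedModType R) (x : V) (C : R) :
  (forall n, `|x| <= C * 2^-1 ^+ n) -> x = 0.
Proof.
move=> xC; apply/eqP; rewrite -normr_le0; apply/negP => /negP.
rewrite -ltNge => /(half_pow_small C)[n] /(le_lt_trans (xC n)).
by rewrite ltxx.
Qed.

Lemma geometric_tail (R : realType) (V : normedModType R) (v : nat -> V)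
    (l : V) (C : R) :
  (forall n, `|v n.+1 - v n| <= C * 2^-1 ^+ n) -> v @ \oo --> l ->
  forall n, `|l - v n| <= 2 * C * 2^-1 ^+ n.
Proof.
move=> vC vl n.
have tail m : `|v (m + n)%N - v n| <= 2 * C * 2^-1 ^+ n * (1 - 2^-1 ^+ m).
  elim: m => [|m IH]; first by rewrite add0n subrr normr0 expr0 subrr mulr0.
  rewrite addSn -(subrKA (v (m + n)%N)) (le_trans (ler_normD _ _))//.
  have := lerD (vC (m + n)%N) IH.
  move=> /le_trans; apply; rewrite exprD exprS.
  by rewrite le_eqVlt; apply/orP; left; apply/eqP; by field.
have C0 : 0 <= C by have := vC 0%N; rewrite expr0 mulr1; apply: le_trans.
have h : `|v m - v n| @[m --> \oo] --> `|l - v n|.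
  by apply: cvg_norm; apply: cvgB => //; exact: cvg_cst.
apply: (cvgr_to_le h); near=> m.
have nm : (n <= m)%N by near: m; exact: nbhs_infty_ge.
rewrite -(subnK nm); apply: (le_trans (tail _)).
rewrite -[leRHS]mulr1 ler_wpM2l//.
  by rewrite !mulr_ge0// exprn_ge0// invr_ge0.
Unshelve. all: by end_near. Qed.

Section Picard.
Variables (R : realType) (V : normedModType R) (cV : calculus_space V).

Lemma exp_growth_bound (L c : R) (D d : R -> V) : 0 <= c -> continuous D ->
  (forall t : R, 0 < t -> is_derive t 1 D (d t)) -> D 0 = 0 ->
  (forall t : R, 0 < t -> `|d t| <= c * (L * expR (L * t))) ->
  forall t : R, 0 <= t -> `|D t| <= c * expR (L * t).
Proof.
move=> c0 cD dD D0 dc.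
have dG (t : R) :
    is_derive t 1 (fun s => c * expR (L * s)) (c * (L * expR (L * t))).
  exact: (is_deriveZ c (is_derive_expR_mull L t)).
apply: (growth_bound cV cD _ dD (fun t _ => dG t) _ dc) => //.
- move=> t; apply/differentiable_continuous/derivable1_diffP.
  by have [] := dG t.
- by rewrite D0 normr0 mulr_ge0// expR_ge0.
Qed.

(** The iterates [w n] are primitives of [f t (p + w (n - 1) t)]; the solution
is [p] plus their limit.  If two iterates differ by at most [c e^(2 L t)], then
the speeds of the next two differ by at most [c L e^(2 L t)], which is half the
derivative of that weight: one iteration halves the distance, uniformly on the
half-line with respect to the weight.  The same estimate, applied to the
primitive [F] of the equation of the limit, shows that [F] is the limit, which
is how the limit gets its derivative. *)
Lemma picard (f : R -> V -> V) (L M : R) (p : V) : 0 < L ->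
  (forall u : R -> V, continuous u -> continuous (fun t => f t (u t))) ->
  (forall t x y, `|f t x - f t y| <= L * `|x - y|) ->
  (forall t, `|f t p| <= M) ->
  exists u : R -> V, [/\ continuous u, forall t : R, t <= 0 -> u t = p &
    forall t : R, 0 < t -> is_derive t 1 u (f t (u t))].
Proof.
move=> L0 cf lf fM.
have M0 : 0 <= M by apply: le_trans (fM 0).
have [P hP] : {P : (R -> V) -> (R -> V) & forall g, continuous g ->
    forward_primitive g (P g)}.
  apply: (@choice _ _ (fun g F => continuous g -> forward_primitive g F)) => g.
  have [cg|ncg] := pselect (continuous g); last by exists g.
  by have [F hF] := primitive_ex cV cg; exists F.
pose w := fix w n :=
  if n is m.+1 then P (fun t => f t (p + w m t)) else fun=> 0.
have cpw (u : R -> V) : continuous u -> continuous (fun t => f t (p + u t)).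
  move=> cu; apply: cf => t; apply: cvgD; [exact: cvg_cst|exact: cu].
have cw n : continuous (w n).
  elim: n => [|n IH] /=; first by move=> t; exact: cvg_cst.
  by have [] := hP _ (cpw _ IH).
have hw n : forward_primitive (fun t => f t (p + w n t)) (w n.+1).
  exact: hP (cpw _ (cw n)).
have w0 n (t : R) : t <= 0 -> w n t = 0.
  by case: n => // n; have [_ + _] := hw n; apply.
(* K makes the weight grow at least as fast as the bound M on the initial
   speed: its derivative is M e^(2 L t). *)
pose K := M / (2 * L); pose c (t : R) := K * expR (2 * L * `|t|).
have K0 : 0 <= K by rewrite divr_ge0// mulr_ge0// ltW.
have half0 n : 0 <= (2^-1 : R) ^+ n by rewrite exprn_ge0// invr_ge0.
have c0 t : 0 <= c t by rewrite mulr_ge0// expR_ge0.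
have wstep n (t : R) : `|w n.+1 t - w n t| <= c t * 2^-1 ^+ n.
  have [t0|/ltW t0] := leP t 0.
    by rewrite !w0// subrr normr0 mulr_ge0.
  rewrite /c ger0_norm// mulrAC.
  elim: n t t0 => [|n IH] t t0.
    apply: (@exp_growth_bound _ _ (w 1%N \- w 0%N) (fun t => f t p)) => //.
    - by rewrite expr0 mulr1.
    - by move=> s; apply: cvgB; exact: cw.
    - move=> s s0; have [_ _ /(_ s s0)] := hw 0%N.
      rewrite addr0 => h; rewrite -[f s p]subr0.
      exact: (is_deriveB h (is_derive_cst 0 s 1)).
    - by rewrite /= subr0; have := w0 1%N 0; apply.
    - move=> s s0; apply: le_trans (fM s) _.
      rewrite expr0 mulr1 mulrA divfK; last by rewrite mulf_neq0// gt_eqF.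
      rewrite ler_peMr// -expR0 ler_expR mulr_ge0// ?ltW// mulr_gt0//.
  apply: (@exp_growth_bound _ _ (w n.+2 \- w n.+1)
    (fun t => f t (p + w n.+1 t) - f t (p + w n t))) => //.
  - exact: mulr_ge0.
  - by move=> s; apply: cvgB; exact: cw.
  - move=> s s0; have [_ _ /(_ s s0) h1] := hw n.+1.
    have [_ _ /(_ s s0) h0] := hw n.
    exact: (is_deriveB h1 h0).
  - move: (w0 n.+2 0 (lexx 0)) (w0 n.+1 0 (lexx 0)) => /= -> ->.
    by rewrite subr0.
  - move=> s s0; apply: (le_trans (lf _ _ _)).
    rewrite opprD addrACA subrr add0r.
    apply: (@le_trans _ _ (L * (K * 2^-1 ^+ n * expR (2 * L * s)))).
      by rewrite ler_pM2l//; apply: IH; exact: ltW.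
    rewrite exprS le_eqVlt; apply/orP; left; apply/eqP; by field.
have [u hu] : {u : R -> V & forall t, (w ^~ t) @ \oo --> u t}.
  apply: (@choice _ _ (fun t l => w ^~ t @ \oo --> (l : V))) => s.
  exact: (geometric_cvg cV (v := w ^~ s) (C := c s)).
have utail t n : `|u t - w n t| <= 2 * c t * 2^-1 ^+ n.
  exact: (@geometric_tail _ _ (w ^~ t)).
have cu : continuous u.
  move=> t; apply/cvgrPdist_lt => e e0.
  pose C := K * expR (2 * L * (`|t| + 1)).
  have [n hn] : exists n, 2 * C * 2^-1 ^+ n < e / 3.
    by apply: half_pow_small; lra.
  have cC s : `|s| <= `|t| + 1 -> `|u s - w n s| < e / 3.
    move=> st; apply: le_lt_trans hn; apply: (le_trans (utail _ _)).
    rewrite ler_wpM2r// ler_wpM2l// ler_wpM2l// ler_expR ler_wpM2l//.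
    by rewrite mulr_ge0// ltW.
  have /cvgrPdist_lt/(_ _ ltr01) near1 : (s : R) @[s --> t] --> t.
    exact: cvg_id.
  have e3 : 0 < e / 3 by lra.
  have /cvgrPdist_lt/(_ _ e3) near2 := cw n t.
  near=> s.
  have h1 : `|u t - w n t| < e / 3 by apply: cC; rewrite lerDl.
  have h2 : `|u s - w n s| < e / 3.
    apply: cC; have -> : s = t - (t - s) by rewrite subKr.
    apply: (le_trans (ler_normB _ _)); rewrite lerD2l ltW//.
  have h3 : `|w n t - w n s| < e / 3 by near: s.
  have -> : u t - u s = (u t - w n t) + (w n t - w n s) - (u s - w n s).
    by rewrite addrA subrK opprB addrA subrK.
  apply: (le_lt_trans (ler_normB _ _)).
  have := ler_normD (u t - w n t) (w n t - w n s).
  lra.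
have [cF F0 dF] := hP _ (cpw _ cu).
set F := P _ in cF F0 dF.
have Fw n (t : R) : `|F t - w n.+1 t| <= c t * 2^-1 ^+ n.
  have [t0|/ltW t0] := leP t 0.
    by rewrite F0// w0// subrr normr0 mulr_ge0.
  rewrite /c ger0_norm// mulrAC.
  apply: (@exp_growth_bound _ _ (F \- w n.+1)
    (fun t => f t (p + u t) - f t (p + w n t))) => //.
  - exact: mulr_ge0.
  - by move=> s; apply: cvgB; [exact: cF|exact: cw].
  - move=> s s0; have [_ _ /(_ s s0) h0] := hw n.
    exact: (is_deriveB (dF _ s0) h0).
  - by move: (w0 n.+1 0 (lexx 0)) => /= ->; rewrite F0// subr0.
  - move=> s s0; apply: (le_trans (lf _ _ _)).
    rewrite opprD addrACA subrr add0r.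
    have := utail s n; rewrite /c gtr0_norm// -(ler_pM2l L0).
    move=> /le_trans; apply.
    rewrite le_eqVlt; by apply/orP; left; apply/eqP; ring.
have Fu t : F t = u t.
  apply/eqP; rewrite -subr_eq0; apply/eqP.
  apply: (@half_pow_bound_eq0 _ _ _ (2 * c t)) => n.
  rewrite -(subrKA (w n.+1 t)) (le_trans (ler_normD _ _))//.
  have := lerD (Fw n t) (utail t n.+1); rewrite (distrC (u t)).
  move=> /le_trans; apply.
  rewrite exprS le_eqVlt; apply/orP; left; apply/eqP; by field.
exists (fun t => p + u t); split.
- by move=> t; apply: cvgD; [exact: cvg_cst|exact: cu].
- by move=> t t0; rewrite -Fu F0// addr0.
- move=> t t0; have eF : F = u by apply/funext.
  have := dF t t0; rewrite eF => du; rewrite -[f _ _]add0r.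
  exact: (is_deriveD (is_derive_cst p t 1) du).
Unshelve. all: by end_near. Qed.
End Picard.

(** * Functions that are Lipschitz on bounded intervals, and truncation *)

Section Lipschitz.
Variable R : realType.
Implicit Types f g : R -> R.

Definition lipschitz_ball (M : R) f := exists2 L : R, 0 <= L &
  forall x y, `|x| <= M -> `|y| <= M -> `|f x - f y| <= L * `|x - y|.

Lemma lipschitz_ball_cst M a : lipschitz_ball M (fun=> a).
Proof. by exists 0 => // x y _ _; rewrite subrr normr0 mul0r. Qed.

Lemma lipschitz_ball_id M : lipschitz_ball M id.
Proof. by exists 1 => // x y _ _; rewrite mul1r. Qed.

Lemma lipschitz_ballD M f g : lipschitz_ball M f -> lipschitz_ball M g ->
  lipschitz_ball M (fun x => f x + g x).
Proof.
move=> [K K0 fK] [L L0 gL]; exists (K + L); first exact: addr_ge0.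
move=> x y xM yM; rewrite opprD addrACA mulrDl.
by apply: (le_trans (ler_normD _ _)); apply: lerD; [exact: fK|exact: gL].
Qed.

Lemma lipschitz_ball_bounded M f : lipschitz_ball M f ->
  exists2 B, 0 <= B & forall x, `|x| <= M -> `|f x| <= B.
Proof.
move=> [K K0 fK]; have [M0|M0] := leP 0 M; last first.
  by exists 0 => // x xM; have := le_trans (normr_ge0 x) xM; rewrite leNgt M0.
exists (`|f 0| + K * M); first by rewrite addr_ge0// mulr_ge0.
move=> x xM; have -> : f x = f 0 + (f x - f 0) by rewrite addrC subrK.
apply: (le_trans (ler_normD _ _)); rewrite lerD2l.
apply: (le_trans (fK x 0 xM _)); first by rewrite normr0.
by rewrite subr0 ler_wpM2l.
Qed.

Lemma lipschitz_ballM M f g : lipschitz_ball M f -> lipschitz_ball M g ->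
  lipschitz_ball M (fun x => f x * g x).
Proof.
move=> lf lg; have [A A0 fA] := lipschitz_ball_bounded lf.
have [B B0 gB] := lipschitz_ball_bounded lg.
have [K K0 fK] := lf; have [L L0 gL] := lg.
exists (A * L + B * K); first by rewrite addr_ge0// mulr_ge0.
move=> x y xM yM.
have -> : f x * g x - f y * g y = f x * (g x - g y) + g y * (f x - f y) by ring.
apply: (le_trans (ler_normD _ _)); rewrite !normrM mulrDl -!mulrA.
apply: lerD; apply: ler_pM => //.
- exact: fA.
- exact: gL.
- exact: gB.
- exact: fK.
Qed.

Lemma lipschitz_ballX M n : lipschitz_ball M (fun x => x ^+ n).
Proof.
elim: n => [|n IH]; first exact: lipschitz_ball_cst.
have := lipschitz_ballM (lipschitz_ball_id M) IH.
by congr lipschitz_ball; apply/funext => x; rewrite exprS.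
Qed.

Lemma lipschitz_ball_even_poly M k (a : nat -> R) :
  lipschitz_ball M (even_poly_fun k a).
Proof.
elim: k => [|k IH].
  rewrite (_ : even_poly_fun _ _ = fun=> 0); first exact: lipschitz_ball_cst.
  by apply/funext => x; rewrite /even_poly_fun big_geq.
rewrite (_ : even_poly_fun _ _ = fun x => even_poly_fun k a x +
    a (2 * k.+1)%N * x ^+ (2 * k.+1)).
  apply: lipschitz_ballD => //.
  by apply: lipschitz_ballM; [exact: lipschitz_ball_cst|exact: lipschitz_ballX].
by apply/funext => x; rewrite /even_poly_fun big_nat_recr.
Qed.

Lemma lipschitz_continuous f (L : R) :
  (forall x y, `|f x - f y| <= L * `|x - y|) -> continuous f.
Proof.
move=> fL x; apply/cvgrPdist_lt => e e0.
have L0 : 0 < `|L| + 1 by rewrite ltr_wpDl.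
have /cvgrPdist_lt/(_ (e / (`|L| + 1))) : (y : R) @[y --> x] --> x.
  exact: cvg_id.
move=> /(_ (divr_gt0 e0 L0)); apply: filterS => y.
rewrite ltr_pdivlMr// mulrC; apply: le_lt_trans; apply: (le_trans (fL x y)).
by rewrite ler_wpM2r// (le_trans (ler_norm L))// lerDl.
Qed.

Definition clamp (M x : R) := Num.max (- M) (Num.min M x).

Lemma clamp_norm M x : 0 <= M -> `|clamp M x| <= M.
Proof.
move=> M0; rewrite ler_norml /clamp.
by case: (leP M x) => h1; [case: (leP (- M) M)|case: (leP (- M) x)] => h2;
  apply/andP; split; lra.
Qed.

Lemma clamp_id M x : `|x| <= M -> clamp M x = x.
Proof.
rewrite ler_norml => /andP[? ?]; rewrite /clamp.
by case: (leP M x) => h1; [case: (leP (- M) M)|case: (leP (- M) x)] => h2;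
  lra.
Qed.

Lemma clamp_mul_ge0 M x : 0 <= M -> 0 <= x * clamp M x.
Proof.
move=> M0; rewrite /clamp.
by case: (leP M x) => h1; [case: (leP (- M) M)|case: (leP (- M) x)] => h2;
  nra.
Qed.

Lemma clamp_lipschitz M x y : 0 <= M -> `|clamp M x - clamp M y| <= `|x - y|.
Proof.
move=> M0; wlog xy : x y / x <= y.
  by move=> h; have [/h//|/ltW/h] := leP x y; rewrite distrC (distrC y).
suff : 0 <= clamp M y - clamp M x <= y - x.
  move=> /andP[h1 h2]; rewrite distrC (distrC x) !ger0_norm//.
  by rewrite subr_ge0.
rewrite /clamp.
by case: (leP M x) => h1; case: (leP M y) => h2;
  case: (leP (- M) M) => h3; case: (leP (- M) x) => h4;
  case: (leP (- M) y) => h5; apply/andP; split; lra.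
Qed.

End Lipschitz.

(** * Existence of trajectories *)

Section Flow.
Variable R : realType.

Lemma even_poly_ge0 k (a : nat -> R) z :
  (forall i : nat, (1 <= i <= k)%N -> 0 < a (2 * i)%N) ->
  0 <= even_poly_fun k a z.
Proof.
move=> a0; rewrite /even_poly_fun big_nat_cond; apply: sumr_ge0 => i.
rewrite andbT ltnS => /a0 ai.
by rewrite mulr_ge0// ?(ltW ai)// mulnC exprM sqr_ge0.
Qed.

Lemma even_poly_le k (a : nat -> R) z w :
  (forall i : nat, (1 <= i <= k)%N -> 0 < a (2 * i)%N) ->
  z ^+ 2 <= w ^+ 2 -> even_poly_fun k a z <= even_poly_fun k a w.
Proof.
move=> a0 zw; rewrite /even_poly_fun big_nat_cond [leRHS]big_nat_cond.
apply: ler_sum => i; rewrite andbT ltnS => /a0 ai.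
by rewrite ler_pM2l// !exprM lerXn2r// nnegrE sqr_ge0.
Qed.

Lemma even_poly_ge k (a : nat -> R) z : (1 <= k)%N ->
  (forall i : nat, (1 <= i <= k)%N -> 0 < a (2 * i)%N) ->
  a 2%N * z ^+ 2 <= even_poly_fun k a z.
Proof.
move=> k1 a0; rewrite /even_poly_fun big_ltn//= muln1 lerDl.
rewrite big_nat_cond; apply: sumr_ge0 => i.
rewrite andbT ltnS => /andP[i2 ik].
rewrite mulr_ge0//; first by rewrite ltW// a0// ik (ltnW i2).
by rewrite mulnC exprM sqr_ge0.
Qed.

(** The truncated equation has a solution by [picard]; as [z] times its
truncation is nonnegative, [z^2] does not increase along it, so the truncation
is never active.  Times before 0 are included in the bound because the
coefficients of the planar equation must be bounded on the whole line. *)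
Lemma height_exists k (a : nat -> R) (z0 : R) :
  (forall i : nat, (1 <= i <= k)%N -> 0 < a (2 * i)%N) ->
  exists z : R -> R, [/\ continuous z, z 0 = z0,
      forall t : R, `|z t| <= `|z0| &
    forall t : R, 0 < t -> is_derive t 1 z (- z t * even_poly_fun k a (z t))].
Proof.
move=> a0; pose M : R := `|z0|.
have M0 : 0 <= M by exact: normr_ge0.
have [L L0 lipL] : lipschitz_ball M (fun z => - z * even_poly_fun k a z).
  apply: lipschitz_ballM (lipschitz_ball_even_poly _ _ _).
  have := lipschitz_ballM (lipschitz_ball_cst M (-1)) (lipschitz_ball_id M).
  by congr lipschitz_ball; apply/funext => x; rewrite mulN1r.
pose f (z : R) : R := - clamp M z * even_poly_fun k a (clamp M z).
have fL x y : `|f x - f y| <= (L + 1) * `|x - y|.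
  apply: (le_trans (lipL _ _ _ _)); rewrite ?clamp_norm//.
  apply: ler_pM => //; first by rewrite lerDl.
  exact: clamp_lipschitz.
have cf : continuous f by exact: lipschitz_continuous fL.
have [|u cu|t x y|t|z [cz zN dz]] :=
    @picard R R (calculus_space_real R) (fun=> f) (L + 1) `|f z0| z0.
- by rewrite ltr_wpDl.
- by move=> t; exact: (cvg_comp u f (cu t) (cf (u t))).
- exact: fL.
- by [].
have zM (t : R) : `|z t| <= `|z0|.
  have [t0|t0] := leP t 0; first by rewrite zN.
  rewrite -(zN 0)// -ler_sqr ?nnegrE// !real_normK ?num_real// -lerN2.
  apply: (@nondecreasing_forward _ (fun s => - z s ^+ 2)
    (fun s => 2 * (z s * clamp M (z s)) *
              even_poly_fun k a (clamp M (z s)))) => //.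
  - by apply: cvg_at_right_filter; apply: cvgN; exact: (cvgM (cz 0) (cz 0)).
  - move=> s s0.
    apply: is_derive_eq (is_deriveN (is_deriveM (dz s s0) (dz s s0))) _.
    rewrite /f /GRing.scale /=; ring.
  - move=> s s0; rewrite mulr_ge0 ?even_poly_ge0// mulr_ge0//.
    exact: clamp_mul_ge0.
  - exact: ltW.
exists z; split => //; first exact: zN.
by move=> t /dz; rewrite /f clamp_id.
Qed.

(** With the height known, the planar equation is linear, with coefficients
bounded by a multiple of [R(z0)]; the Lipschitz constant is an operator norm
bound for the sup norm. *)
Lemma flow_exists (a b c : R) k (coef : nat -> R) (p : R * R * R) :
  (forall i : nat, (1 <= i <= k)%N -> 0 < coef (2 * i)%N) ->
  exists X, forward_solution (vector_field a b c (even_poly_fun k coef)) p X.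
Proof.
move=> a0; have [z [cz z0 zM dz]] := height_exists p.2 a0.
pose rho t := even_poly_fun k coef (z t).
have crho : continuous rho.
  have [L L0 lipL] := lipschitz_ball_even_poly `|p.2| k coef.
  pose g x := even_poly_fun k coef (clamp `|p.2| x).
  have -> : rho = g \o z by apply/funext => t; rewrite /g /= clamp_id.
  have cg : continuous g.
    apply: (@lipschitz_continuous _ _ L) => x y.
    apply: (le_trans (lipL _ _ _ _)); rewrite ?clamp_norm//.
    by rewrite ler_wpM2l// clamp_lipschitz.
  by move=> t; exact: (cvg_comp z g (cz t) (cg (z t))).
pose B := even_poly_fun k coef p.2.
have B0 : 0 <= B by exact: even_poly_ge0.
have rhoB t : `|rho t| <= B.
  rewrite ger0_norm ?even_poly_ge0//; apply: even_poly_le => //.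
  rewrite -[z t ^+ 2]real_normK ?num_real// -[p.2 ^+ 2]real_normK ?num_real//.
  by rewrite lerXn2r ?nnegrE.
pose f t (u : R * R) := (u.2 + (a * u.1 + b * u.2) * rho t,
                        - u.1 + (- b * u.1 + c * u.2) * rho t) : R * R.
pose L := 1 + (`|a| + `|b| + `|c|) * B.
have L0 : 0 < L by rewrite ltr_pwDl// mulr_ge0// !addr_ge0.
have coord m n r (u : R * R) t :
  `|m| + `|n| <= `|a| + `|b| + `|c| ->
  `|r| <= `|u| -> `|r + (m * u.1 + n * u.2) * rho t| <= L * `|u|.
  move=> hmn hr.
  apply: (le_trans (ler_normD _ _)); rewrite /L [leRHS]mulrDl mul1r lerD//.
  have := lexx `|u|; rewrite prod_norm_le => /andP[u1 u2].
  rewrite normrM mulrAC ler_pM//.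
  apply: (le_trans (ler_normD _ _)); rewrite !normrM.
  apply: (@le_trans _ _ ((`|m| + `|n|) * `|u|)).
    by rewrite mulrDl lerD// ler_wpM2l.
  by rewrite ler_wpM2r.
have fL t u : `|f t u| <= L * `|u|.
  have := lexx `|u|; rewrite prod_norm_le => /andP[u1 u2].
  by rewrite prod_norm_le; apply/andP; split; apply: coord;
    rewrite ?normrN//; have := normr_ge0 a; have := normr_ge0 b;
    have := normr_ge0 c; lra.
have fB t u v : f t u - f t v = f t (u - v).
  by congr pair => /=; ring.
have [|u cu t|t x y|t|u [cu u0 du]] := @picard R (R * R)%type
    (calculus_space_prod (calculus_space_real R) (calculus_space_real R))
    f L (L * `|p.1|) p.1 => //.
- have cu1 : (u s).1 @[s --> t] --> (u t).1 := continuous_fst cu (x := t).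
  have cu2 : (u s).2 @[s --> t] --> (u t).2 := continuous_snd cu (x := t).
  have cst (r : R) : cst r s @[s --> t] --> r by exact: cvg_cst.
  have lin (m n : R) : (m * (u s).1 + n * (u s).2) * rho s @[s --> t] -->
      (m * (u t).1 + n * (u t).2) * rho t.
    exact: (cvgM (cvgD (cvgM (cst m) cu1) (cvgM (cst n) cu2)) (crho t)).
  exact: (cvg_pair (cvgD cu2 (lin a b)) (cvgD (cvgN cu1) (lin (- b) c))).
- by rewrite fB.
exists (fun t => (u t, z t)); split.
- by rewrite u0// z0 -surjective_pairing.
- by apply: continuous_subspaceT; exact: continuous_pair.
- move=> t t0; rewrite /vector_field; case E : (u t) => [x y].
  have := is_derive_pair (du t t0) (dz t t0).
  rewrite E /f /= => h; apply: is_derive_eq h _.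
  by congr pair; rewrite /= add0r.
Qed.
End Flow.

(** * Attraction off the plane and rotation inside it *)

Section Attraction.
Variables (R : realType) (k : nat) (coef : nat -> R).
Hypothesis k1 : (1 <= k)%N.
Hypothesis coef0 : forall i : nat, (1 <= i <= k)%N -> 0 < coef (2 * i)%N.
Let P := even_poly_fun k coef.

Let P_ge0 x : 0 <= P x. Proof. exact: even_poly_ge0. Qed.

Section Height.
Variable z : R -> R.
Hypothesis z_right : z s @[s --> 0^'+] --> z 0.
Hypothesis dz : forall t : R, 0 < t -> is_derive t 1 z (- z t * P (z t)).
Hypothesis z0 : z 0 != 0.

Lemma is_derive_height_sq (t : R) : 0 < t ->
  is_derive t 1 (fun s => z s ^+ 2) (- (2 * P (z t) * z t ^+ 2)).
Proof.
move=> t0; apply: is_derive_eq (is_deriveM (dz t0) (dz t0)) _.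
rewrite /GRing.scale /=; ring.
Qed.

Lemma height_sq_right : z s ^+ 2 @[s --> 0^'+] --> z 0 ^+ 2.
Proof. exact: (cvgM z_right z_right). Qed.

Lemma height_sq_le (t : R) : 0 <= t -> z t ^+ 2 <= z 0 ^+ 2.
Proof.
move=> t0; rewrite -lerN2.
apply: (@nondecreasing_forward _ (fun s => - z s ^+ 2)
  (fun s => 2 * P (z s) * z s ^+ 2)) => //.
- exact: cvgN height_sq_right.
- move=> s s0; rewrite -[X in is_derive _ _ _ X]opprK.
  exact: is_deriveN (is_derive_height_sq s0).
- by move=> s _; rewrite mulr_ge0 ?sqr_ge0// mulr_ge0.
Qed.

(** Gronwall: [R(z)] is at most [R(z 0)] along the trajectory, so [z^2] decays
no faster than [e^(- 2 R(z 0) t)]. *)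
Lemma height_sq_gt0 (t : R) : 0 <= t -> 0 < z t ^+ 2.
Proof.
move=> t0; pose M := 2 * P (z 0).
have : z 0 ^+ 2 * expR (M * 0) <= z t ^+ 2 * expR (M * t).
  apply: (@nondecreasing_forward _ (fun s => z s ^+ 2 * expR (M * s))
    (fun s => z s ^+ 2 * expR (M * s) * (M - 2 * P (z s)))) => //.
  - have cE : {for 0, continuous (fun s => expR (M * s))}.
      apply/differentiable_continuous/derivable1_diffP.
      by have [] := is_derive_expR_mull M 0.
    exact: (cvgM height_sq_right (cvg_at_right_filter cE)).
  - move=> s s0; apply: is_derive_eq
      (is_deriveM (is_derive_height_sq s0) (is_derive_expR_mull M s)) _.
    rewrite /GRing.scale /=; ring.
  - move=> s s0; apply: mulr_ge0; first by rewrite mulr_ge0 ?sqr_ge0 ?expR_ge0.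
    rewrite subr_ge0 ler_pM2l//.
    by apply: even_poly_le => //; apply: height_sq_le; exact: ltW.
rewrite mulr0 expR0 mulr1 => h.
have : 0 < z t ^+ 2 * expR (M * t).
  by apply: lt_le_trans h; rewrite exprn_even_gt0.
by rewrite pmulr_lgt0// expR_gt0.
Qed.

(** The lowest term of [R] alone gives [(1 / z^2)' = 2 R(z) / z^2 >= 2 a_2]. *)
Lemma height_sq_decay (t : R) : 0 <= t -> 2 * coef 2%N * t < (z t ^+ 2)^-1.
Proof.
move=> t0.
have : (z 0 ^+ 2)^-1 - 2 * coef 2%N * 0 <= (z t ^+ 2)^-1 - 2 * coef 2%N * t.
  apply: (@nondecreasing_forward _ (fun s => (z s ^+ 2)^-1 - 2 * coef 2%N * s)
    (fun s => 2 * P (z s) / (z s ^+ 2) - 2 * coef 2%N)) => //.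
  - apply: cvgB.
      by apply: (cvgV _ height_sq_right); rewrite expf_neq0.
    by apply: cvg_at_right_filter; apply: cvgM; [exact: cvg_cst|exact: cvg_id].
  - move=> s s0; have ws := height_sq_gt0 (ltW s0).
    have zs : z s != 0 by move: ws; rewrite exprn_even_gt0.
    apply: (is_deriveB _ (is_derive_mull (2 * coef 2%N) s)).
    apply: is_derive_eq (is_deriveV _ (is_derive_height_sq s0)) _.
      exact: lt0r_neq0.
    by rewrite /GRing.scale /=; field.
  - move=> s s0; have ws := height_sq_gt0 (ltW s0).
    rewrite subr_ge0 ler_pdivlMr// -mulrA ler_pM2l//.
    exact: even_poly_ge.
rewrite mulr0 subr0 => h.
have : 0 < (z 0 ^+ 2)^-1 by rewrite invr_gt0 exprn_even_gt0.
lra.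
Qed.

Lemma height_sq_small (e : R) : 0 < e -> \forall t \near +oo, z t ^+ 2 < e.
Proof.
move=> e0; have c2 : 0 < coef 2%N by have := @coef0 1%N; apply.
near=> t.
have t0 : 0 < t by near: t; exact: nbhs_pinfty_gt.
have te : e^-1 / (2 * coef 2%N) < t.
  by near: t; apply: nbhs_pinfty_gt; exact: num_real.
have := height_sq_decay (ltW t0); have ws := height_sq_gt0 (ltW t0).
move: te; rewrite ltr_pdivrMr ?mulr_gt0// mulrC => te /(lt_trans te).
by rewrite ltf_pV2.
Unshelve. all: by end_near. Qed.

(** [r w^a], written with [w^a = e^(a ln w)], has derivative
[2 (c - a) y^2 R(z) w^a <= 0]: the decay of the height compensates exactly that
of the direction [x], and the direction [y] decays at least as fast. *)
Lemma radius_bound (a b c : R) (x y : R -> R) (t : R) : c <= a ->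
  x s @[s --> 0^'+] --> x 0 -> y s @[s --> 0^'+] --> y 0 ->
  (forall t : R, 0 < t ->
    is_derive t 1 x (y t + (a * x t + b * y t) * P (z t))) ->
  (forall t : R, 0 < t ->
    is_derive t 1 y (- x t + (- b * x t + c * y t) * P (z t))) ->
  0 <= t ->
  (x t ^+ 2 + y t ^+ 2) * expR (a * ln (z t ^+ 2)) <=
  (x 0 ^+ 2 + y 0 ^+ 2) * expR (a * ln (z 0 ^+ 2)).
Proof.
move=> ca x_right y_right dx dy t0; rewrite -lerN2.
pose r s := x s ^+ 2 + y s ^+ 2; pose E s := expR (a * ln (z s ^+ 2)).
apply: (@nondecreasing_forward _ (fun s => - (r s * E s))
  (fun s => 2 * (a - c) * y s ^+ 2 * P (z s) * E s)) => //.
- have r_right : r s @[s --> 0^'+] --> r 0.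
    exact: (cvgD (cvgM x_right x_right) (cvgM y_right y_right)).
  have ln_right : a * ln (z s ^+ 2) @[s --> 0^'+] --> a * ln (z 0 ^+ 2).
    apply: cvgM; first exact: cvg_cst.
    exact: (cvg_comp (fun s => z s ^+ 2) _ height_sq_right
      (continuous_ln (height_sq_gt0 (lexx 0)))).
  exact: (cvgN (cvgM r_right (cvg_comp _ _ ln_right (@continuous_expR R _)))).
- move=> s s0; have ws := height_sq_gt0 (ltW s0).
  have zs : z s != 0 by move: ws; rewrite exprn_even_gt0.
  have dln := is_derive1_comp (f := @ln R) (g := fun s => z s ^+ 2)
    (is_derive1_ln ws) (is_derive_height_sq s0).
  have dE := is_derive1_comp (f := @expR R) (g := fun s => a * ln (z s ^+ 2))
    (is_derive_expR _) (is_deriveZ a dln).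
  have dr := is_deriveD (is_deriveM (dx s s0) (dx s s0))
    (is_deriveM (dy s s0) (dy s s0)).
  apply: is_derive_eq (is_deriveN (is_deriveM dr dE)) _.
  rewrite /GRing.scale /= /r /E.
  have -> : (x * x + y * y) s = x s * x s + y s * y s by [].
  field. exact: zs.
- move=> s s0; do 2 (apply: mulr_ge0; rewrite ?expR_ge0//).
  by rewrite mulr_ge0 ?sqr_ge0// mulr_ge0// subr_ge0.
Qed.
End Height.

(** A quantitative form of: [w^(-a)] tends to 0 with [w] when [a < 0].  The
threshold comes from [exp (a ln w) > exp (C / e) >= 1 + C / e]. *)
Lemma small_of_log_weight (a C w r e : R) : a < 0 -> 0 <= r -> 0 < e -> 0 < w ->
  r * expR (a * ln w) <= C -> w < expR (C / e / a) -> r < e.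
Proof.
move=> a0 r0 e0 w0 rC wC.
have C0 : 0 <= C by apply: le_trans rC; rewrite mulr_ge0// expR_ge0.
have : C / e < a * ln w.
  rewrite [ltRHS]mulrC -ltr_ndivlMr//.
  by rewrite -[X in _ < X]expRK ltr_ln// posrE ?expR_gt0.
move=> h; rewrite ltNge; apply/negP => er.
have h1 : 1 + C / e < expR (a * ln w).
  by apply: lt_le_trans (expR_ge1Dx _); rewrite ltrD2l.
have : e * (1 + C / e) < C.
  apply: lt_le_trans rC; apply: (@lt_le_trans _ _ (e * expR (a * ln w))).
    by rewrite ltr_pM2l.
  by rewrite ler_wpM2r// expR_ge0.
by rewrite mulrDr mulr1 mulrCA divff ?gt_eqF// mulr1; lra.
Qed.

Lemma converges_off_plane (a b c : R) (p : R * R * R) (X : R -> R * R * R) :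
  c <= a -> a < 0 -> p.2 != 0 ->
  forward_solution (vector_field a b c P) p X -> converges_to_origin X.
Proof.
move=> ca a0 p2 [X0 /continuous_within_itvcyP[_ XR] dX].
pose x t := (X t).1.1; pose y t := (X t).1.2; pose z t := (X t).2.
have zR : z s @[s --> 0^'+] --> z 0.
  exact: (cvg_comp _ _ XR (@cvg_snd _ _ _ _ _)).
have uR : (X s).1 @[s --> 0^'+] --> (X 0).1.
  exact: (cvg_comp _ _ XR (@cvg_fst _ _ _ _ _)).
have xR : x s @[s --> 0^'+] --> x 0.
  exact: (cvg_comp _ _ uR (@cvg_fst _ _ _ _ _)).
have yR : y s @[s --> 0^'+] --> y 0.
  exact: (cvg_comp _ _ uR (@cvg_snd _ _ _ _ _)).
have dX' (t : R) : 0 < t -> is_derive t 1 X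
    ((y t + (a * x t + b * y t) * P (z t),
     - x t + (- b * x t + c * y t) * P (z t)), - z t * P (z t)).
  move=> /dX h; apply: is_derive_eq h _; rewrite /x /y /z /vector_field.
  by case: (X t) => [[? ?] ?]; congr pair; rewrite /= add0r.
have dz (t : R) : 0 < t -> is_derive t 1 z (- z t * P (z t)).
  by move=> /dX'/is_derive_snd.
have dx (t : R) : 0 < t ->
    is_derive t 1 x (y t + (a * x t + b * y t) * P (z t)).
  by move=> /dX'/is_derive_fst/is_derive_fst.
have dy (t : R) : 0 < t ->
    is_derive t 1 y (- x t + (- b * x t + c * y t) * P (z t)).
  by move=> /dX'/is_derive_fst/is_derive_snd.
have z0 : z 0 != 0 by rewrite /z X0.
apply/cvgr0Pnorm_lt => e e0.
have e2 : 0 < e ^+ 2 by rewrite exprn_gt0.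
pose C := (x 0 ^+ 2 + y 0 ^+ 2) * expR (a * ln (z 0 ^+ 2)).
near=> t.
have t0 : 0 <= t by near: t; exact: nbhs_pinfty_ge.
have zt : z t ^+ 2 < e ^+ 2 by near: t; exact: height_sq_small.
have zt' : z t ^+ 2 < expR (C / e ^+ 2 / a).
  by near: t; apply: height_sq_small => //; exact: expR_gt0.
have rt : x t ^+ 2 + y t ^+ 2 < e ^+ 2.
  apply: (small_of_log_weight (C := C) a0 _ e2
    (height_sq_gt0 zR dz z0 t0) _ zt').
    by rewrite addr_ge0// sqr_ge0.
  exact: (radius_bound zR dz z0 ca xR yR dx dy).
have abs_lt (u : R) : u ^+ 2 < e ^+ 2 -> `|u| < e.
  by move=> h; rewrite -ltr_sqr ?nnegrE ?(ltW e0)// real_normK// num_real.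
rewrite prod_normE gt_max prod_normE gt_max -andbA.
apply/and3P; split; apply: abs_lt => //.
- by apply: le_lt_trans rt; rewrite lerDl sqr_ge0.
- by apply: le_lt_trans rt; rewrite lerDr sqr_ge0.
Unshelve. all: by end_near. Qed.

Lemma not_locally_attractive (a b c : R) :
  ~ locally_attractive (vector_field a b c P).
Proof.
move=> [d d0 attr].
have P0 : P 0 = 0.
  rewrite /P /even_poly_fun big_nat big1// => i /andP[i1 _].
  by rewrite expr0n muln_eq0 /= -leqn0 leqNgt i1 /= mulr0.
have [s s0 sd] : exists2 s, 0 < s & s < d by exists (d / 2); lra.
pose X (t : R) : R * R * R := ((s * cos t, - (s * sin t)), 0).
have dX (t : R) : is_derive t 1 X (vector_field a b c P (X t)).
  have h : is_derive t 1 X ((s * - sin t, - (s * cos t)), 0).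
    exact: (is_derive_pair (is_derive_pair (is_deriveZ s (is_derive_cos t))
      (is_deriveN (is_deriveZ s (is_derive_sin t))))
      (is_derive_cst (0 : R) t 1)).
  apply: is_derive_eq h _; rewrite /X /vector_field P0 !mulr0.
  by congr pair; [congr pair|]; rewrite /= addr0 ?mulrN.
have solX : forward_solution (vector_field a b c P) ((s, 0), 0) X.
  split.
  - by rewrite /X cos0 sin0 mulr1 mulr0 oppr0.
  - apply: continuous_subspaceT => t.
    by apply/differentiable_continuous/derivable1_diffP; have [] := dX t.
  - by move=> t _; exact: dX.
have [_ /(_ X solX)] : trajectory_satisfies (vector_field a b c P)
    (@converges_to_origin R _) ((s, 0), 0).
  by apply: attr; rewrite !prod_normE /= normr0 !gt_max d0 !andbT gtr0_norm.
move=> /cvgr0Pnorm_lt/(_ (s / 2)) /=; rewrite divr_gt0// => /(_ isT) near0.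
(* |cos t| and |sin t| would both be less than 1/2. *)
near (pinfty_nbhs R) => t.
have : `|X t| < s / 2 by near: t.
rewrite /X !prod_normE /= !gt_max normrN !normrM (gtr0_norm s0) !ltr_pM2l//.
move=> /andP[/andP[ct st] _].
have := cos2Dsin2 t.
rewrite -(real_normK (num_real (cos t))) -(real_normK (num_real (sin t))).
have := normr_ge0 (cos t); have := normr_ge0 (sin t); nra.
Unshelve. all: by end_near. Qed.

End Attraction.

Lemma negligible_plane (R : realType) :
  (@lebesgue_measure3 R).-negligible [set p | p.2 = 0].
Proof.
exists (setT `*` [set 0]); split.
- by apply: measurableX; [exact: measurableT|exact: measurable_set1].
- rewrite /lebesgue_measure3 product_measure1E//.
  by rewrite [X in (_ * X)%E](lebesgue_measure_set1 (0 : R)) mule0.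
- by move=> p /= p0; split.
Qed.

Theorem corollary3p5 (R : realType) (a b c : R) (k : nat) (coef : nat -> R)
    (hca : c <= a) (ha : a < 0) (hk : (1 <= k)%N)
    (hcoef : forall i : nat, (1 <= i <= k)%N -> 0 < coef (2 * i)%N) :
  almost_global_attractor (vector_field a b c (even_poly_fun k coef)) /\
  ~ locally_asymptotically_stable (vector_field a b c (even_poly_fun k coef)).
Proof.
split; last by case=> _; exact: not_locally_attractive.
apply: negligibleS (negligible_plane R) => p /= np.
apply/eqP/negPn/negP => p2; apply: np; split; first exact: flow_exists.
by move=> X; exact: converges_off_plane.
Qed.
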